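(* There is a category $\mathfrak B$ whose objects are graph burnings and whose morphisms are morphisms of graph burnings.
   Context: A graph $G=(V_G,E_G)$ is a non-empty finite set $V_G$ of vertices together with a set $E_G$ of unordered pairs of distinct vertices. A graph map $f\colon G\to H$ is a map $f\colon V_G\to V_H$ such that for every edge $\{v,w\}\in E_G$ either $\{f(v),f(w)\}\in E_H$ or $f(v)=f(w)$. The path graph $P_n$ has vertices $\{1,\dots,n\}$ and edges $\{i,i+1\}$, $i=1,\dots,n-1$. The distance $d_G(v,w)$ is the length of a shortest path from $v$ to $w$ ($\infty$ if there is none). Let $S_G=(v_1,\dots,v_k)$, $k\ge 1$, be a non-empty ordered set of vertices of $G$. For $2\le j\le k+1$ let $U_j$ be the induced subgraph of $G$ on the vertices $w$ such that $d_G(v_i,w)\le j-i$ for some $1\le i\le j-1$. For $1\le j\le k+1$ let $\mathcal N_j$ be the induced subgraph of $G$ on the vertices $w$ such that $d_G(v_i,w)\le j-i$ for some $1\le i\le \min(j,k)$. The sequence $S_G$ is a burning sequence if $v_j\notin U_j$ for $2\le j\le k$ and $U_{k+1}=G$. In this case $\lambda_G(v)=\min\{i\mid v\in\mathcal N_i\}$ for $v\in V_G$; the pair $\mathbf B(G)=(\lambda_G,S_G)$ is called a burning of $G$, and $T^G=\max\{\lambda_G(v)\mid v\in V_G\}$ is its end time. The function $\lambda_G$ is a graph map $G\to P_{T^G}$. Let $\mathbf B(G)=(\lambda_G,S_G)$ and $\mathbf B(H)=(\lambda_H,S_H)$ be burnings of graphs $G$, $H$ with $S_G=(v_1,\dots,v_k)$,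 $S_H=(w_1,\dots,w_m)$ and end times $T^G$, $T^H$. A graph map $f\colon G\to H$ is a morphism of burnings $\mathbf B(G)\to\mathbf B(H)$ if $k\le m$, $f(v_i)=w_i$ for $1\le i\le k$, and there is a graph map $\tau\colon P_{T^G}\to P_{T^H}$ with $\tau\circ\lambda_G=\lambda_H\circ f$. Composition and identities are those of graph maps. *)

(* Defs.v *)
From mathcomp Require Import all_boot.

Set Implicit Arguments.
Unset Strict Implicit.
Unset Printing Implicit Defensive.

Record graph := Graph {
  vertex :> finType;
  adj : rel vertex;
  adj_sym : symmetric adj;
  adj_irr : irreflexive adj;
  graph_nonempty : 0 < #|vertex|
}.

Record graph_map (G H : graph) := GraphMap {
  gm_fun :> G -> H;
  gm_adj : forall v w : G,
    adj v w -> adj (gm_fun v) (gm_fun w) \/ gm_fun v = gm_fun w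
}.

Section PathGraph.

Variables (n : nat) (n_gt0 : 0 < n).

(* The vertex type is literally {1, ..., n}. *)
Definition path_vertex : finType := seq_sub (iota 1 n).

Definition path_adj : rel path_vertex :=
  fun i j => ((ssval i).+1 == ssval j) || ((ssval j).+1 == ssval i).

Lemma path_adj_sym : symmetric path_adj.
Proof. by move=> i j; rewrite /path_adj orbC. Qed.

Lemma path_adj_irr : irreflexive path_adj.
Proof. by move=> i; rewrite /path_adj orbb gtn_eqF. Qed.

Lemma path_vertex_nonempty : 0 < #|path_vertex|.
Proof. by rewrite card_seq_sub ?iota_uniq // size_iota. Qed.

Definition path_graph : graph :=
  Graph path_adj_sym path_adj_irr path_vertex_nonempty.

End PathGraph.

Section Distance.

Variable G : graph.
Implicit Types v w : G.

Definition walk (n : nat) v w : bool :=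
  [exists p : n.-tuple G, path (@adj G) v p && (last v p == w)].

Lemma walkP n v w :
  reflect (exists p : seq G, [/\ path (@adj G) v p, last v p = w & size p = n])
          (walk n v w).
Proof.
apply: (iffP existsP) => [[p /andP[pP /eqP lP]]|[p [pP lP /eqP sP]]].
  by exists p; rewrite size_tuple.
by exists (Tuple sP); rewrite /= pP lP eqxx.
Qed.

Lemma connect_walk v w : connect (@adj G) v w -> exists n, walk n v w.
Proof.
by case/connectP=> p pP lP; exists (size p); apply/walkP; exists p.
Qed.

(* None stands for an infinite distance. *)
Definition dist v w : option nat :=
  match boolP (connect (@adj G) v w) with
  | AltTrue vw => Some (ex_minn (connect_walk vw))
  | AltFalse _ => None
  end.

Definition dist_le v w (n : nat) : bool :=
  if dist v w is Some d then d <= n else false.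

Lemma dist_leP v w n :
  reflect (exists2 m, m <= n & walk m v w) (dist_le v w n).
Proof.
rewrite /dist_le /dist; case: {-}_ / boolP => [vw|nvw].
  case: ex_minnP => d wd dmin; apply: (iffP idP) => [dn|[m mn wm]].
    by exists d.
  exact: leq_trans (dmin m wm) mn.
apply: ReflectF => -[m _ /walkP[p [pP lP _]]].
by case/negP: nvw; apply/connectP; exists p.
Qed.

Lemma dist_le_adj u v w n : adj v w -> dist_le u v n -> dist_le u w n.+1.
Proof.
move=> vw /dist_leP[m mn /walkP[p [pP lP sP]]].
apply/dist_leP; exists m.+1 => //; apply/walkP; exists (rcons p w).
by rewrite rcons_path last_rcons size_rcons pP lP sP.
Qed.

End Distance.

Section BurningSequence.

Variables (G : graph) (k : nat) (S : k.-tuple G).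

(* Indices: v_i is tnth S i', where i' : 'I_k has value i - 1. The induced
   subgraphs U_j (burnt_before j) and N_j (burnt_at j) are represented by
   their vertex sets, so that U_(k+1) = G is an equality with [set: G]. *)
Definition burnt_before (j : nat) : {set G} :=
  [set w | [exists i : 'I_k, (i.+1 <= j.-1) && dist_le (tnth S i) w (j - i.+1)]].

Definition burnt_at (j : nat) : {set G} :=
  [set w | [exists i : 'I_k,
     (i.+1 <= minn j k) && dist_le (tnth S i) w (j - i.+1)]].

Definition burning_sequence : Prop :=
  (forall j : 'I_k, 2 <= j.+1 -> tnth S j \notin burnt_before j.+1)
  /\ burnt_before k.+1 = [set: G].

End BurningSequence.

(* The component lambda_G of the pair (lambda_G, S_G) is determined by S_G,
   hence it is not a field but the definition burn_time below; burn_lambda is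
   the same function as a graph map to the path graph on {1, ..., T^G}. *)
Record burning := Burning {
  bgraph : graph;
  blength : nat;
  bsources : blength.-tuple bgraph;
  blength_gt0 : 0 < blength;
  bsources_uniq : uniq bsources;
  bsourcesP : burning_sequence bsources
}.

Section BurningTheory.

Variable B : burning.
Let G := bgraph B.

Lemma burnt_ex (v : G) :
  exists j, (1 <= j <= (blength B).+1) && (v \in burnt_at (bsources B) j).
Proof.
exists (blength B).+1; rewrite leqnn /=.
have [_ /setP/(_ v)] := bsourcesP B; rewrite !inE => /existsP[i /andP[_ di]].
by apply/existsP; exists i; rewrite di leq_min ltn_ord ltnS ltnW.
Qed.

Definition burn_time (v : G) : nat := ex_minn (burnt_ex v).

Definition end_time : nat := \max_(v : G) burn_time v.

Lemma burn_time_gt0 v : 0 < burn_time v.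
Proof. by rewrite /burn_time; case: ex_minnP => j /andP[/andP[]]. Qed.

Lemma burn_time_le_end v : burn_time v <= end_time.
Proof. exact: (leq_bigmax (F := burn_time)). Qed.

Lemma end_time_gt0 : 0 < end_time.
Proof.
have /card_gt0P[v _] := graph_nonempty G.
exact: leq_trans (burn_time_gt0 v) (burn_time_le_end v).
Qed.

Lemma burn_time_adj v w : adj v w -> burn_time w <= (burn_time v).+1.
Proof.
move=> vw; rewrite /burn_time.
case: (ex_minnP (burnt_ex v)) => a /andP[/andP[a0 ak] va] _.
case: ex_minnP => b /andP[/andP[b0 bk] _] bmin.
have [le_ak|ka] := leqP a (blength B); last by apply: leq_trans bk _; apply: leqW.
apply: bmin; rewrite /= ltnS le_ak /=; move: va; rewrite !inE.
case/existsP=> i /andP[]; rewrite leq_min => /andP[ia _] di.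
apply/existsP; exists i; rewrite leq_min ltn_ord leqW //= subSn //.
exact: dist_le_adj vw di.
Qed.

Definition burn_end : graph := path_graph end_time_gt0.

Lemma burn_time_path v : burn_time v \in iota 1 end_time.
Proof. by rewrite mem_iota burn_time_gt0 add1n ltnS burn_time_le_end. Qed.

Definition burn_vertex (v : G) : burn_end := SeqSub (burn_time_path v).

Lemma burn_vertex_adj (v w : G) : adj v w ->
  adj (burn_vertex v) (burn_vertex w) \/ burn_vertex v = burn_vertex w.
Proof.
move=> vw; have := burn_time_adj vw.
have := @burn_time_adj w v; rewrite adj_sym vw => /(_ isT).
have [lt_vw _|lt_wv|e _ _] := ltngtP (burn_time v) (burn_time w).
- move=> le; left; rewrite /= /path_adj /=.
  by rewrite eqn_leq lt_vw le.
- move=> le _; left; rewrite /= /path_adj /=; apply/orP; right.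
  by rewrite eqn_leq lt_wv le.
- by right; apply: val_inj.
Qed.

Definition burn_lambda : graph_map G burn_end := GraphMap burn_vertex_adj.

End BurningTheory.

Definition is_burning_morphism (B C : burning)
    (f : graph_map (bgraph B) (bgraph C)) : Prop :=
  exists le_BC : blength B <= blength C,
    (forall i : 'I_(blength B),
       f (tnth (bsources B) i) = tnth (bsources C) (widen_ord le_BC i))
    /\ (exists tau : graph_map (burn_end B) (burn_end C),
          forall v : bgraph B, tau (burn_lambda B v) = burn_lambda C (f v)).

Record burning_morphism (B C : burning) := BurningMorphism {
  bm_map :> graph_map (bgraph B) (bgraph C);
  bm_prop : is_burning_morphism bm_map
}.

Record category (Ob : Type) (Hom : Ob -> Ob -> Type) := Category {
  cat_id : forall A : Ob, Hom A A;
  cat_comp : forall A B C : Ob, Hom B C -> Hom A B -> Hom A C;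
  cat_compA : forall (A B C D : Ob) (h : Hom C D) (g : Hom B C) (f : Hom A B),
    cat_comp h (cat_comp g f) = cat_comp (cat_comp h g) f;
  cat_comp1f : forall (A B : Ob) (f : Hom A B), cat_comp (cat_id B) f = f;
  cat_compf1 : forall (A B : Ob) (f : Hom A B), cat_comp f (cat_id A) = f
}.

(* Main.v *)
Require Import Defs.
From mathcomp Require Import all_boot.
From Stdlib Require Import ProofIrrelevance.

Set Implicit Arguments.
Unset Strict Implicit.
Unset Printing Implicit Defensive.

(** Burnings are graphs with extra structure and their morphisms are graph maps
    with a property, so it is enough that this property holds for identities
    and is stable under composition; the category laws are then those of
    functions. An edge may be collapsed by a graph map, and a collapsed edge
    stays collapsed, hence graph maps compose. For morphisms of burnings
    [f : B -> C] and [g : C -> D] with path maps [tau] and [sigma], the squares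
    [tau \o lambda_B = lambda_C \o f] and [sigma \o lambda_C = lambda_D \o g]
    paste to [(sigma \o tau) \o lambda_B = lambda_D \o (g \o f)], and the
    source conditions chain along the inclusions of index sets
    (lemmas [is_burning_morphism_id] and [is_burning_morphism_comp]).

    Composition of functions is associative and unital by conversion, so the
    laws only require identifying proofs of the same property; this is where
    proof irrelevance enters ([eq_burning_morphism]). *)

Definition graph_map_id (G : graph) : graph_map G G :=
  @GraphMap G G id (fun v w vw => or_introl vw).

Lemma comp_adj (G H K : graph) (g : graph_map H K) (f : graph_map G H)
    (v w : G) :
  adj v w -> adj (g (f v)) (g (f w)) \/ g (f v) = g (f w).
Proof. by case/(gm_adj f) => [/(gm_adj g)|->]; last right. Qed.

Definition graph_map_comp (G H K : graph) (g : graph_map H K)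
    (f : graph_map G H) : graph_map G K :=
  @GraphMap G K (fun v => g (f v)) (comp_adj g f).

Lemma is_burning_morphism_id (B : burning) :
  is_burning_morphism (graph_map_id (bgraph B)).
Proof.
exists (leqnn _); split; last by exists (graph_map_id _).
by move=> i; congr tnth; apply: val_inj.
Qed.

Lemma is_burning_morphism_comp (B C D : burning)
    (g : graph_map (bgraph C) (bgraph D))
    (f : graph_map (bgraph B) (bgraph C)) :
  is_burning_morphism g -> is_burning_morphism f ->
  is_burning_morphism (graph_map_comp g f).
Proof.
move=> [le_CD [gS [sigma g_lambda]]] [le_BC [fS [tau f_lambda]]].
exists (leq_trans le_BC le_CD); split=> [i|].
  by rewrite /= fS gS; congr tnth; apply: val_inj.
exists (graph_map_comp sigma tau) => v.
by rewrite [LHS]/= f_lambda g_lambda.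
Qed.

Definition burning_id (B : burning) : burning_morphism B B :=
  BurningMorphism (is_burning_morphism_id B).

Definition burning_comp (B C D : burning) (g : burning_morphism C D)
    (f : burning_morphism B C) : burning_morphism B D :=
  BurningMorphism (is_burning_morphism_comp (bm_prop g) (bm_prop f)).

(** The hypothesis compares functions, not their values: in the category laws
    the two sides are convertible as functions. Beyond the function, a morphism
    only carries proofs of propositions. *)
Lemma eq_burning_morphism (B C : burning) (f g : burning_morphism B C) :
  gm_fun f = gm_fun g -> f = g.
Proof.
case: f g => [[f f_adj] fP] [[g g_adj] gP] /= eq_fg.
case: g / eq_fg in g_adj gP *.
case: g_adj / (proof_irrelevance _ f_adj g_adj) in gP *.
by rewrite (proof_irrelevance _ fP gP).
Qed.

Theorem theorem3p18 :
  exists C : category burning_morphism,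
    (forall (A : burning) (v : bgraph A), cat_id C A v = v)
    /\ (forall (A B D : burning)
          (g : burning_morphism B D) (f : burning_morphism A B)
          (v : bgraph A),
          cat_comp C g f v = g (f v)).
Proof.
unshelve eexists.
  by apply: (@Category _ _ burning_id burning_comp) => *;
     apply: eq_burning_morphism.
by [].
Qed.
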